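(* For $i=1,2$, suppose that $l^i:\Omega_T\times[0,T]\times\mathbb{R}\to\mathbb{R}$ and $S^i$ satisfy ($H_l$), ($H'_l$) (with the same constants $c_l,C_l$ for $i=1,2$) and ($H_S$), and let $(X^i,A^i)$ be the solution of the Skorokhod problem with mean reflection $\mathbb{SP}(l^i,S^i)$. Then there exists a constant $C$ depending on $c_l,C_l$ such that $$\sup_{t\in[0,T]}|A^1_t-A^2_t|\le C\Big\{\sup_{t\in[0,T]}\widehat{\mathbb{E}}\Big[\sup_{x\in\mathbb{R}}|l^1(t,x)-l^2(t,x)|\Big]+\sup_{t\in[0,T]}\widehat{\mathbb{E}}|S^1_t-S^2_t|\Big\}$$ and $$\widehat{\mathbb{E}}\Big[\sup_{t\in[0,T]}|X^1_t-X^2_t|\Big]\le C\Big\{\sup_{t\in[0,T]}\widehat{\mathbb{E}}\Big[\sup_{x\in\mathbb{R}}|l^1(t,x)-l^2(t,x)|\Big]+\widehat{\mathbb{E}}\Big[\sup_{t\in[0,T]}|S^1_t-S^2_t|\Big]\Big\}.$$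
   Context: **$G$-expectation framework.** Fix $T>0$ and $0<\underline{\sigma}^2<\overline{\sigma}^2$; $\Omega_T$ is the space of real-valued continuous functions on $[0,T]$ starting from $0$, with the supremum norm and Borel $\sigma$-algebra $\mathcal{B}(\Omega_T)$; $B$ is the canonical process; $G(a)=\frac12(\overline{\sigma}^2a^+-\underline{\sigma}^2a^-)$. $L_{ip}(\Omega_T)$ is the set of $\varphi(B_{t_1},\dots,B_{t_n})$ with $n\in\mathbb{N}$, $t_i\in[0,T]$, $\varphi$ bounded Lipschitz on $\mathbb{R}^n$. The $G$-expectation of $\xi=\varphi(B_{t_1},\dots,B_{t_n})$, $0=t_0\le t_1<\dots<t_n$, is $\widehat{\mathbb{E}}[\xi]=u_1(0,0)$, where, backwards in $k$, $u_k(t,x;x_1,\dots,x_{k-1})$ is the (viscosity) solution of $\partial_tu_k+G(\partial_x^2u_k)=0$ on $[t_{k-1},t_k)\times\mathbb{R}$ with terminal condition $u_n(t_n,x;x_1,\dots,x_{n-1})=\varphi(x_1,\dots,x_{n-1},x)$ and $u_k(t_k,x;x_1,\dots,x_{k-1})=u_{k+1}(t_k,x;x_1,\dots,x_{k-1},x)$ for $k<n$. $L_G^p(\Omega_T)$ ($p\ge1$) is the completion of $L_{ip}(\Omega_T)$ under $\|\xi\|_{L_G^p}=(\widehat{\mathbb{E}}|\xi|^p)^{1/p}$. There is a weakly compact set $\mathcal{P}$ of probability measures on $(\Omega_T,\mathcal{B}(\Omega_T))$ with $\widehat{\mathbb{E}}[\xi]=\sup_{\mathsf{P}\in\mathcal{P}}\mathsf{E}^{\mathsf{P}}[\xi]$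 for $\xi\in L_G^1(\Omega_T)$; the same formula defines $\widehat{\mathbb{E}}$ for other measurable random variables. A property holds quasi-surely (q.s.) if it holds outside a set $N$ with $\sup_{\mathsf{P}\in\mathcal{P}}\mathsf{P}(N)=0$; random variables that are equal q.s. are identified, and inequalities between random variables are understood q.s. **Process spaces.** $S_G^0(0,T)$ is the set of processes $f(t,B_{t_1\wedge t},\dots,B_{t_n\wedge t})$ with $t_i\in[0,T]$, $f$ bounded Lipschitz on $\mathbb{R}^{n+1}$; $S_G^p(0,T)$ is its completion under $\|\eta\|_{S_G^p}=(\widehat{\mathbb{E}}\sup_{t\in[0,T]}|\eta_t|^p)^{1/p}$. $I[0,T]$ is the set of deterministic continuous nondecreasing functions on $[0,T]$ with initial value $0$. **Assumptions** (dependence on $\omega$ is suppressed). ($H_l$) $l:\Omega_T\times[0,T]\times\mathbb{R}\to\mathbb{R}$ satisfies: (1) $l(t,x)$ is uniformly continuous in $(t,x)$, uniformly in $\omega$; (2) for every $t$, $x\mapsto l(t,x)$ is strictly increasing, q.s.; (3) for every $(t,x)$, $l(t,x)\in L_G^1(\Omega_T)$, and $\widehat{\mathbb{E}}[\lim_{x\uparrow\infty}l(t,x)]>0$; (4) for some $\kappa>0$, $|l(t,x)|\le\kappa(1+|x|)$ q.s. for every $(t,x)$. ($H'_l$) There are an increasing continuous function $F:[0,\infty)\to[0,\infty)$ with $F(0)=0$ and constants $0<c_l<C_l$ such that (1) $|l(t,x)-l(s,x)|\le F(|t-s|)$ for all $t,s\in[0,T]$, $x\in\mathbb{R}$; (2)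 $c_l|x-y|\le|l(t,x)-l(t,y)|\le C_l|x-y|$ for all $t\in[0,T]$, $x,y\in\mathbb{R}$. ($H_S$) There exists $p\ge1$ such that $S\in S_G^p(0,T)$, and $\widehat{\mathbb{E}}[l(0,S_0)]\ge0$. **Skorokhod problem with mean reflection.** A solution of $\mathbb{SP}(l,S)$ is a pair $(X,A)\in S_G^p(0,T)\times I[0,T]$ such that for $t\in[0,T]$: (a) $X_t=S_t+A_t$; (b) $\widehat{\mathbb{E}}[l(t,X_t)]\ge0$; (c) $\int_0^T\widehat{\mathbb{E}}[l(t,X_t)]\,dA_t=0$. Under ($H_l$) and ($H_S$) it has exactly one solution. *)

(* Defs.v *)
From HB Require Import structures.
From mathcomp Require Import all_boot all_order all_algebra.
From mathcomp Require Import all_classical all_reals all_analysis.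
(* The sigma-algebra of \bar R is not re-exported by all_analysis. *)
From mathcomp Require Import measurable_realfun.
Import Order.TTheory GRing.Theory Num.Theory.
Import numFieldNormedType.Exports.

Set Implicit Arguments.
Unset Strict Implicit.
Unset Printing Implicit Defensive.

Local Open Scope classical_set_scope.
Local Open Scope ring_scope.

(* Functions of a time t in [0,T] are represented by functions on the whole
   line R; except in cpath, only their values on [0,T] are constrained or used. *)

Section PathSpace.
Context {R : realType}.
Implicit Type T : R.

(* The requirement that a path vanish outside [0,T] selects one representative
   per continuous function on [0,T] starting from 0. *)
Record cpath T := CPath {
  cpath_fun :> R -> R ;
  cpath_continuous : {within `[0, T], continuous cpath_fun} ;
  cpath0 : cpath_fun 0 = 0 ;
  cpath_out : forall t, ~ `[0, T]%classic t -> cpath_fun t = 0 }.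

Lemma zero_path_continuous T : {within `[0, T], continuous (fun _ : R => 0 : R)}.
Proof. by apply: continuous_subspaceT => x; exact: cvg_cst. Qed.

Definition zero_path T : cpath T :=
  CPath (@zero_path_continuous T) erefl (fun _ _ => erefl).

HB.instance Definition _ T := gen_eqMixin (cpath T).
HB.instance Definition _ T := gen_choiceMixin (cpath T).
HB.instance Definition _ T := isPointed.Build (cpath T) (zero_path T).

(* Uniform convergence on [0,T] is the topology of the supremum norm. *)
HB.instance Definition _ T := Topological.copy (cpath T)
  (initial_topology (@cpath_fun T : cpath T -> {uniform` `[0, T] -> R})).

(* cpath T with its Borel sigma-algebra.  The canonical process is
   B_t(w) = (w : cpath T) t. *)
Definition Omega T : measurableType (@open (cpath T)).-sigma :=
  g_sigma_algebraType (@open (cpath T)).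

Definition bounded_lipschitz (V : normedModType R) (f : V -> R) : Prop :=
  bounded_fun f /\ [lipschitz f x | x in [set: V]].

End PathSpace.

Section GHeat.
Context {R : realType}.
Variables sl su : R.

Definition Gfun (a : R) : R :=
  2^-1 * (su ^+ 2 * Num.max a 0 - sl ^+ 2 * Num.max (- a) 0).

Definition dt (h : R -> R -> R) (t x : R) : R := derive1 (fun s => h s x) t.
Definition dx (h : R -> R -> R) (t x : R) : R := derive1 (h t) x.
Definition dxx (h : R -> R -> R) : R -> R -> R := dx (dx h).

Definition continuous2 (h : R -> R -> R) : Prop :=
  continuous (fun z : R * R => h z.1 z.2).

Record C12 (h : R -> R -> R) : Prop := MkC12 {
  C12_dt : forall t x : R, derivable (fun s => h s x) t 1 ;
  C12_dx : forall t x : R, derivable (h t) x 1 ;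
  C12_dxx : forall t x : R, derivable (dx h t) x 1 ;
  C12_cont : continuous2 h ;
  C12_cont_dt : continuous2 (dt h) ;
  C12_cont_dx : continuous2 (dx h) ;
  C12_cont_dxx : continuous2 (dxx h) }.

(* Maxima and minima are relative to the domain [a,b[ x R of the equation
   dt u + G (dxx u) = 0, which is posed backwards from time b. *)
Definition viscosity_sub (a b : R) (u : R -> R -> R) : Prop :=
  forall (h : R -> R -> R) (t x : R), C12 h -> a <= t < b ->
    (\forall z \near ((t, x) : R * R), a <= z.1 < b ->
       u z.1 z.2 - h z.1 z.2 <= u t x - h t x) ->
    0 <= dt h t x + Gfun (dxx h t x).

Definition viscosity_super (a b : R) (u : R -> R -> R) : Prop :=
  forall (h : R -> R -> R) (t x : R), C12 h -> a <= t < b ->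
    (\forall z \near ((t, x) : R * R), a <= z.1 < b ->
       u t x - h t x <= u z.1 z.2 - h z.1 z.2) ->
    dt h t x + Gfun (dxx h t x) <= 0.

(* For bounded continuous terminal data g there is exactly one solution in the
   class of bounded continuous functions (up to its values off [a,b] x R). *)
Record viscosity_solution (a b : R) (g : R -> R) (u : R -> R -> R) : Prop :=
  MkViscositySolution {
  vs_cont : {within [set z : R * R | a <= z.1 <= b],
               continuous (fun z => u z.1 z.2)} ;
  vs_bounded : exists M : R, forall t x : R, a <= t <= b -> `|u t x| <= M ;
  vs_sub : viscosity_sub a b u ;
  vs_super : viscosity_super a b u ;
  vs_terminal : forall x, u b x = g x }.

(* With ts = [:: t_1; ...; t_n] and xs = [:: x_1; ...; x_(k-1)],
   u xs t x stands for u_k(t, x; x_1, ..., x_(k-1)): the length of xs encodes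
   k, so that (0 :: ts)`_(size xs) is t_(k-1) and ts`_(size xs) is t_k. *)
Definition backward_solution (ts : seq R) (phi : 'rV[R]_(size ts) -> R)
    (u : seq R -> R -> R -> R) : Prop :=
  forall xs : seq R, (size xs < size ts)%N ->
    viscosity_solution (0 :: ts)`_(size xs) ts`_(size xs)
      (fun x => if (size xs).+1 == size ts
                then phi (\row_i (rcons xs x)`_i)
                else u (rcons xs x) ts`_(size xs) x)
      (u xs).

Definition is_G_expectation (ts : seq R) (phi : 'rV[R]_(size ts) -> R) (v : R)
    : Prop :=
  exists2 u : seq R -> R -> R -> R, backward_solution phi u & u [::] 0 0 = v.

End GHeat.

Section UpperExpectation.
Context {R : realType}.
Variable T : R.
Local Notation Omega := (Omega T).
Local Notation proba := (probability Omega R).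

Definition test_fun := {f : cpath T -> R | continuous f /\ bounded_fun f}.

Definition test_eval (P : proba) : {ptws test_fun -> R} :=
  fun f => \int[P]_w (sval f w).

(* The topology of weak convergence: the coarsest one for which P |-> E^P[f]
   is continuous for every bounded continuous f. *)
Definition weakly_compact (Ps : set proba) : Prop :=
  @compact (initial_topology test_eval) Ps.

Definition cylinder (ts : seq R) (phi : 'rV[R]_(size ts) -> R) (w : Omega) : R :=
  phi (\row_i (w : cpath T) ts`_i).

Definition L_ip (X : Omega -> R) : Prop :=
  exists (ts : seq R) (phi : 'rV[R]_(size ts) -> R),
    [/\ {in ts, forall t : R, 0 <= t <= T}, bounded_lipschitz phi &
        X = cylinder phi].

Definition S_G0 (eta : R -> Omega -> R) : Prop :=
  exists (ts : seq R) (f : R * 'rV[R]_(size ts) -> R),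
    [/\ {in ts, forall t : R, 0 <= t <= T}, bounded_lipschitz f &
        forall (t : R) (w : Omega), 0 <= t <= T ->
          eta t w = f (t, \row_i (w : cpath T) (Num.min ts`_i t))].

Variable Ps : set proba.

(* Extended-real valued, so that it is defined on all random variables. *)
Definition Ehat (X : Omega -> \bar R) : \bar R :=
  ereal_sup [set (\int[P]_w X w)%E | P in Ps].

(* Ps is a weakly compact set of probability measures whose upper expectation
   is the G-expectation on L_ip (hence on its completion L_G^1). *)
Definition represents_G_expectation (sl su : R) : Prop :=
  weakly_compact Ps /\
  forall (ts : seq R) (phi : 'rV[R]_(size ts) -> R),
    (0 < size ts)%N -> sorted <%R ts -> {in ts, forall t : R, 0 <= t <= T} ->
    bounded_lipschitz phi ->
    exists2 v : R, is_G_expectation sl su phi v &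
      Ehat (fun w => (cylinder phi w)%:E) = v%:E.

Definition quasi_surely (Q : Omega -> Prop) : Prop :=
  exists N : set Omega, [/\ measurable N,
    ereal_sup [set P N | P in Ps] = 0%E & forall w, ~ N w -> Q w].

Definition L_G_norm (p : R) (X : Omega -> R) : \bar R :=
  poweR (Ehat (fun w => (`|X w| `^ p)%:E)) p^-1.

(* The completion is realized as the measurable functions that are limits of
   elements of L_ip in norm; two such functions are the same element of the
   completion iff they are equal quasi-surely. *)
Definition L_G (p : R) (X : Omega -> R) : Prop :=
  measurable_fun [set: Omega] X /\
  exists2 xi : nat -> Omega -> R, forall n, L_ip (xi n) &
    L_G_norm p (fun w => X w - xi n w) @[n --> \oo] --> 0%E.

Definition S_G_norm (p : R) (eta : R -> Omega -> R) : \bar R :=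
  poweR (Ehat (fun w => ereal_sup [set (`|eta t w| `^ p)%:E | t in `[0, T]]))
    p^-1.

(* As for L_G.  The measurability of the supremum over the uncountable set
   [0,T] is required so that the norm is meaningful; it is automatic for the
   representatives with continuous paths. *)
Definition S_G (p : R) (eta : R -> Omega -> R) : Prop :=
  (forall t : R, 0 <= t <= T -> measurable_fun [set: Omega] (eta t)) /\
  exists zeta : nat -> R -> Omega -> R,
    [/\ forall n, S_G0 (zeta n),
        forall n, measurable_fun [set: Omega]
          (fun w => ereal_sup [set `|eta t w - zeta n t w|%:E | t in `[0, T]]) &
        S_G_norm p (fun t w => eta t w - zeta n t w) @[n --> \oo] --> 0%E].

End UpperExpectation.

Section IncreasingFunctions.
Context {R : realType}.
Variable T : R.

(* I[0,T] *)
Record incr := Incr {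
  incr_fun :> R -> R ;
  incr_continuous : {within `[0, T], continuous incr_fun} ;
  incr_nd : {in `[0, T] &, {homo incr_fun : s t / s <= t}} ;
  incr0 : incr_fun 0 = 0 }.

Definition clamp (t : R) : R := Num.max 0 (Num.min t T).

(* A, extended from [0,T] to the line by constants; the measure dA on [0,T] is
   the Lebesgue-Stieltjes measure of this extension, which has no mass outside
   [0,T] and no atoms. *)
Definition incr_ext (A : incr) (t : R) : R := A (clamp t).

Lemma clamp_continuous : continuous clamp.
Proof.
move=> x; rewrite /clamp.
have c0 : (0 : R) @[_ --> x] --> (0 : R) by exact: cvg_cst.
have cT : T @[_ --> x] --> T by exact: cvg_cst.
have cm : Num.min t T @[t --> x] --> Num.min x T.
  exact: (continuous_min (f := id) (g := fun=> T) cvg_id cT).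
exact: (continuous_max (f := fun=> 0) (g := fun t => Num.min t T) c0 cm).
Qed.

Lemma clamp_nd : nondecreasing clamp.
Proof.
move=> s t st; rewrite /clamp ge_max !le_max lexx /=; apply/orP; right.
by rewrite le_min !ge_min st lexx orbT.
Qed.

Lemma clamp_in t : 0 <= T -> clamp t \in `[0, T].
Proof.
move=> T0; rewrite in_itv/= /clamp le_max lexx /=.
by rewrite ge_max T0 ge_min lexx orbT.
Qed.

Lemma clamp_lt0 t : T < 0 -> clamp t = 0.
Proof.
by move=> T0; apply/max_idPl; rewrite ge_min (ltW T0) orbT.
Qed.

Lemma incr_ext_nd (A : incr) : nondecreasing (incr_ext A).
Proof.
move=> s t st; rewrite /incr_ext; case: (leP 0 T) => T0; last first.
  by rewrite !clamp_lt0.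
by apply: incr_nd; rewrite ?clamp_in// clamp_nd.
Qed.

Lemma incr_ext_continuous (A : incr) : continuous (incr_ext A).
Proof.
move=> x; case: (leP 0 T) => T0; last first.
  rewrite (_ : incr_ext A = fun=> A 0); first exact: cvg_cst.
  by apply/funext => t; rewrite /incr_ext clamp_lt0.
have /subspace_continuousP/(_ (clamp x)) cA := @incr_continuous A.
have {}cA := cA (clamp_in x T0).
have cc : clamp t @[t --> x] --> within `[0, T] (nbhs (clamp x)).
  move=> B wB; have {wB}cB : \forall t \near x, clamp t \in `[0, T] -> B (clamp t).
    exact: (clamp_continuous wB).
  suff : \forall t \near x, B (clamp t) by [].
  by apply: filterS cB => t; apply; exact: clamp_in.
exact: (cvg_comp _ _ cc cA).
Qed.

HB.instance Definition _ (A : incr) := isCumulative.Build R _ R (incr_ext A)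
  (@incr_ext_nd A) (right_continuousW (@incr_ext_continuous A)).

End IncreasingFunctions.

Section MeanReflection.
Context {R : realType}.
Variables (T : R) (Ps : set (probability (Omega T) R)).
Implicit Types (l : Omega T -> R -> R -> R) (S X : R -> Omega T -> R).
Local Notation Ehat := (Ehat Ps).
Local Notation qs := (quasi_surely Ps).

Record H_l l : Prop := MkH_l {
  H_l_unif : forall e : R, 0 < e -> exists2 d : R, 0 < d &
    forall (w : Omega T) (t s x y : R), 0 <= t <= T -> 0 <= s <= T ->
      `|t - s| < d -> `|x - y| < d -> `|l w t x - l w s y| < e ;
  H_l_mono : forall t : R, 0 <= t <= T ->
    qs (fun w => forall x y, x < y -> l w t x < l w t y) ;
  H_l_LG1 : forall t x : R, 0 <= t <= T -> L_G Ps 1 (fun w => l w t x) ;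
  H_l_pos : forall t : R, 0 <= t <= T ->
    (0 < Ehat (fun w => lim ((l w t x)%:E @[x --> +oo%R])))%E ;
  H_l_growth : exists2 kappa : R, 0 < kappa &
    forall t x : R, 0 <= t <= T -> qs (fun w => `|l w t x| <= kappa * (1 + `|x|)) }.

Record H'_l (cl Cl : R) l : Prop := MkH'_l {
  H'_l_time : exists F : R -> R,
    [/\ forall r s : R, 0 <= r <= s -> F r <= F s,
        {within [set r | 0 <= r], continuous F},
        F 0 = 0, forall r : R, 0 <= r -> 0 <= F r &
        forall t s x : R, 0 <= t <= T -> 0 <= s <= T ->
          qs (fun w => `|l w t x - l w s x| <= F `|t - s|)] ;
  H'_l_space : forall t x y : R, 0 <= t <= T ->
    qs (fun w => cl * `|x - y| <= `|l w t x - l w t y| <= Cl * `|x - y|) }.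

Record H_S (p : R) l S : Prop := MkH_S {
  H_S_p : 1 <= p ;
  H_S_proc : S_G Ps p S ;
  H_S_init : (0 <= Ehat (fun w => (l w 0 (S 0 w))%:E))%E }.

Record SP_solution (p : R) l S X (A : incr T) : Prop := MkSP_solution {
  SP_proc : S_G Ps p X ;
  SP_eq : forall t : R, 0 <= t <= T -> qs (fun w => X t w = S t w + A t) ;
  SP_constraint : forall t : R, 0 <= t <= T ->
    (0 <= Ehat (fun w => (l w t (X t w))%:E))%E ;
  SP_flat : (\int[lebesgue_stieltjes_measure (incr_ext A)]_(t in `[0%R, T])
               Ehat (fun w => (l w t (X t w))%:E))%E = 0%E }.

End MeanReflection.

(* Main.v *)
(* Suppose A1 - A2 exceeds b = (m + Cl n) / cl, where m and n bound the
   expected distances of the losses and of S1, S2, and let s be the last earlier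
   time at which A1 - A2 <= c, for some c > b.  After s the bi-Lipschitz bounds
   give E[l1(r, X1_r)] >= E[l2(r, X2_r)] + cl c - Cl n - m > 0, so by flatness A1
   is constant there while A2 is nondecreasing, and A1 - A2 cannot have grown.
   The bound on X1 - X2 = (S1 - S2) + (A1 - A2)
   follows from the almost sure continuity of the paths of X1 and X2. *)
Require Import Defs.
From mathcomp Require Import all_boot all_order all_algebra.
From mathcomp Require Import all_classical all_reals all_analysis.
From mathcomp Require Import measurable_realfun lra.
Import Order.TTheory GRing.Theory Num.Theory.
Import numFieldNormedType.Exports.
Local Open Scope classical_set_scope.
Local Open Scope ring_scope.

Set Implicit Arguments.
Unset Strict Implicit.
Unset Printing Implicit Defensive.

(** Three obstacles shape the details. The suprema over [x] and over [t] are not known to be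
    measurable, so they are never split off by linearity; they are compared only through the simple
    functions below them. The bi-Lipschitz bounds and the identity X = S + A hold off exceptional
    sets that depend on the arguments; they are imposed at rational arguments only, and uniform
    continuity of the loss, respectively continuity of the paths of X, extends their consequences to
    all arguments. Finally [Ehat] is not additive, so the losses are compared under a single measure
    [P], chosen almost optimal for the expectation of l2(r, X2_r): under [P] integrals are additive,
    and the expectation of l1(r, X1_r) under [P] bounds [Ehat] from below, which is the direction
    required. *)

(** * Integrals of possibly non-measurable functions *)

Section LowerIntegral.
Context d (T : measurableType d) (R : realType).
Implicit Types f g : T -> \bar R.

Import HBNNSimple.

(* For nonnegative functions the integral is the supremum over the simple
   functions below, hence monotone without any measurability. *)
Lemma ge0_le_integral_nonmeas (mu : {measure set T -> \bar R}) f g :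
  (forall x, 0 <= f x)%E -> (forall x, f x <= g x)%E ->
  (\int[mu]_x f x <= \int[mu]_x g x)%E.
Proof.
move=> f0 fg; have g0 x : (0 <= g x)%E by exact: le_trans (f0 x) (fg x).
rewrite !ge0_integralTE//; apply: le_ereal_sup => _ [h hf <-].
by exists h => // x; exact: le_trans (hf x) (fg x).
Qed.

(** If [h] is a simple function below [f] and [N] is the exceptional null set, then (h - a)^+ cut
    off on [N] is a measurable function below [g], and adding [a] to it dominates [h] almost
    everywhere. Hence neither [f] nor [g] has to be measurable. *)
Lemma ge0_integral_leD_ae (P : probability T R) f g (a : R) : 0 <= a ->
  (forall x, 0 <= f x)%E -> (forall x, 0 <= g x)%E ->
  {ae P, forall x, (f x <= g x + a%:E)%E} ->
  (\int[P]_x f x <= \int[P]_x g x + a%:E)%E.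
Proof.
move=> a0 f0 g0 [N [mN PN fgN]].
rewrite {1}ge0_integralTE//; apply: ge_ereal_sup => _ [h hf <-].
rewrite -integralT_nnsfun.
pose k x : \bar R := (Num.max (h x - a) 0 * \1_(~` N) x)%:E.
have mk : measurable_fun [set: T] k.
  apply/measurable_EFinP; apply: measurable_funM; last first.
    by apply: measurable_indic; exact: measurableC.
  by apply: measurable_maxr => //; apply: measurable_funB.
have k0 x : (0 <= k x)%E by rewrite lee_fin mulr_ge0// le_max lexx orbT.
have kg x : (k x <= g x)%E.
  rewrite /k indicE; have [xN|] := boolP (x \in ~` N); last by rewrite mulr0.
  rewrite mulr1; move: xN; rewrite inE /= => xN.
  have fg : (f x <= g x + a%:E)%E by apply: contrapT => nfg; exact: xN (fgN _ nfg).
  have := le_trans (hf x) fg; move: (g0 x); case: (g x) => [r| |]//=.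
    by rewrite !lee_fin => r0 hr; rewrite ge_max r0 andbT lerBlDr.
  by move=> _ _; exact: leey.
apply: (@le_trans _ _ (\int[P]_x (k x + a%:E)%E)%E).
  apply: ae_ge0_le_integral => //.
  - by move=> x _; rewrite lee_fin.
  - exact/measurable_EFinP.
  - by move=> x _; rewrite adde_ge0// lee_fin.
  - exact: emeasurable_funD.
  exists N; split => // x /= /not_implyP[_ hk]; apply: contrapT => xN; apply: hk.
  rewrite /k indicE (@mem_set _ (~` N) x xN) mulr1 -EFinD lee_fin.
  by rewrite -lerBlDr le_max lexx.
rewrite ge0_integralD//.
have -> : (\int[P]_x a%:E = a%:E)%E.
  by rewrite (integral_cst P measurableT a%:E) [X in (_ * X)%E](_ : _ = 1%E) ?mule1//; exact: probability_setT.
apply: leeD2r.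
exact: ge0_le_integral_nonmeas.
Qed.

Lemma integral_le_ae (P : probability T R) f g :
  measurable_fun [set: T] f -> (forall x, 0 <= g x)%E ->
  {ae P, forall x, (f x <= g x)%E} -> (\int[P]_x f x <= \int[P]_x g x)%E.
Proof.
move=> mf g0 fg; apply: (@le_trans _ _ (\int[P]_x f^\+ x)%E).
  by rewrite integralE geeDl// oppe_le0 integral_ge0.
rewrite -[leRHS]adde0; apply: (@ge0_integral_leD_ae _ _ _ 0) => //.
apply: filterS fg => x fgx; rewrite adde0 funeposE ge_max fgx /=.
exact: g0.
Qed.

End LowerIntegral.

(** * Flatness of increasing functions under their Stieltjes measure *)

Section FlatIncreasing.
Context (R : realType).

(** The supremum of the times with [f <= b] is itself such a time: a value above [b] there would
    persist on a neighbourhood, which contains times of the set. *)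
Lemma last_time_le (f : R -> R) (b t : R) : continuous f -> 0 <= t -> f 0 <= b ->
  b < f t -> exists s, [/\ 0 <= s <= t, f s <= b & forall r, s < r <= t -> b < f r].
Proof.
move=> cf t0 f0b bft; pose E := [set r | 0 <= r <= t /\ f r <= b].
have E0 : E 0 by rewrite /E /= lexx t0.
have ubE : ubound E t by move=> r [/andP[]].
have hubE : has_ubound E by exists t.
have supE : has_sup E by split => //; exists 0.
exists (sup E); split.
- by rewrite (ub_le_sup hubE E0) ge_sup//; exists 0.
- rewrite leNgt; apply/negP => bs.
  have : \forall r \near sup E, b < f r by exact: (cvgr_gt (f (sup E)) (cf (sup E)) b bs).
  move=> /nbhs_ballP[e /= e0 he].
  have [r Er re] := sup_adherent e0 supE.
  have : b < f r.
    apply: he; rewrite /ball /= ger0_norm ?subr_ge0; last exact: ub_le_sup.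
    by rewrite ltrBlDr -ltrBlDl.
  by case: Er => _; rewrite leNgt => /negP.
move=> r /andP[sr rt]; rewrite ltNge; apply/negP => frb.
have : sup E < r := sr; rewrite ltNge => /negP; apply; apply: ub_le_sup => //.
by split; rewrite // rt andbT (le_trans (ub_le_sup hubE E0))// ltW.
Qed.

(** A Markov-type bound: [eps] times the mass of ]s, t] is at most the integral of [phi], which is
    zero, and that mass is the increment of [A]. *)
Lemma incr_flat (T : R) (A : incr T) (phi : R -> \bar R) (eps s t : R) :
  0 <= s <= t -> t <= T -> 0 < eps ->
  (forall r, 0 <= r <= T -> (0 <= phi r)%E) ->
  (forall r, s < r <= t -> (eps%:E <= phi r)%E) ->
  (\int[lebesgue_stieltjes_measure (incr_ext A)]_(r in `[0%R, T]) phi r = 0)%E ->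
  A t = A s.
Proof.
move=> /andP[s0 st] tT eps0 phi0 phi_eps intphi.
set mu := lebesgue_stieltjes_measure _ in intphi.
have stE : incr_ext A t - incr_ext A s = A t - A s.
  rewrite /incr_ext /clamp (min_idPl tT) (min_idPl (le_trans st tT)).
  by rewrite (max_idPr s0) (max_idPr (le_trans s0 st)).
have mu_st : mu `]s, t]%classic = (A t - A s)%:E.
  rewrite /mu /lebesgue_stieltjes_measure /measure_extension/= measurable_mu_extE/=.
    by rewrite wlength_itv_bnd// stE.
  exact: is_ocitv.
have : (eps%:E * mu `]s, t]%classic <= 0)%E.
  rewrite -intphi integral_mkcond.
  rewrite -(@integral_cst _ _ _ mu `]s, t]%classic)//.
  rewrite integral_mkcond; apply: ge0_le_integral_nonmeas => r.
    by rewrite erestrict_ge0// => x _; rewrite lee_fin ltW.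
  rewrite !patchE; case: ifPn => [|_].
    rewrite inE /= in_itv /= => rst; rewrite mem_set/=; first exact: phi_eps.
    by rewrite in_itv/=; case/andP: rst => sr rt; rewrite (le_trans rt tT) (le_trans s0 (ltW sr)).
  by case: ifPn => //; rewrite inE /= in_itv /=; exact: phi0.
rewrite mu_st -EFinM lee_fin pmulr_rle0// subr_le0 => Ats.
apply/le_anti; rewrite Ats /=; apply: (@incr_nd _ _ A) => //; rewrite in_itv/=.
  by rewrite s0 (le_trans st tT).
by rewrite (le_trans s0 st) tT.
Qed.

Lemma incr_gap_le (T : R) (A1 A2 : incr T) (phi : R -> \bar R) (b : R) :
  0 <= T -> 0 <= b ->
  (forall r, 0 <= r <= T -> (0 <= phi r)%E) ->
  (forall c, b < c -> exists2 eps, 0 < eps & forall r, 0 <= r <= T ->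
    c < A1 r - A2 r -> (eps%:E <= phi r)%E) ->
  (\int[lebesgue_stieltjes_measure (incr_ext A1)]_(r in `[0%R, T]) phi r = 0)%E ->
  forall t, 0 <= t <= T -> A1 t - A2 t <= b.
Proof.
move=> T0 b0 phi0 phi_eps intphi t /andP[t0 tT].
rewrite leNgt; apply/negP => bt.
pose f r := incr_ext A1 r - incr_ext A2 r.
have fE r : 0 <= r <= T -> f r = A1 r - A2 r.
  move=> /andP[r0 rT].
  by rewrite /f /incr_ext /clamp (min_idPl rT) (max_idPr r0).
(* The midpoint keeps a strict margin on both sides: above [b] it yields one [eps] for the whole of
   ]s, t], and below [f t] it makes the last time argument applicable. *)
pose c := (b + (A1 t - A2 t)) / 2.
have bc : b < c by rewrite /c; lra.
have cft : c < f t by rewrite fE ?t0// /c; lra.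
have cf : continuous f.
  by move=> x; apply: continuousB; exact: incr_ext_continuous.
have f0c : f 0 <= c by rewrite fE ?lexx// !incr0 subrr; lra.
have [s [/andP[s0 st] fsc hs]] := last_time_le cf t0 f0c cft.
have [eps eps0 heps] := phi_eps _ bc.
have At : A1 t = A1 s.
  apply: (@incr_flat _ _ phi eps) => //; first by rewrite s0.
  move=> r /andP[sr rt]; have r0T : 0 <= r <= T.
    by rewrite (le_trans s0 (ltW sr)) (le_trans rt tT).
  by apply: heps => //; rewrite -fE// hs// sr.
have A2st : A2 s <= A2 t.
  apply: (@incr_nd _ _ A2) => //; rewrite in_itv/=.
    by rewrite s0 (le_trans st tT).
  by rewrite t0 tT.
move: fsc cft; rewrite !fE ?t0 ?s0 ?(le_trans st tT)// At; lra.
Qed.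

End FlatIncreasing.

(** * Paths of the elementary processes *)

Section ProcessSpace.
Context (R : realType) (T : R).

Lemma bounded_lipschitz_continuous (V : normedModType R) (f : V -> R) :
  bounded_lipschitz f -> continuous f.
Proof.
move=> [_ lf]; have [k k0 hk] : exists2 k, 0 < k &
    forall x y, `|f x - f y| <= k * `|x - y|.
  (* The Lipschitz property speaks of all constants beyond a threshold [k] of unknown sign; this one
     is beyond it and positive. *)
  have [k [_ hk]] := lf; exists (Num.max k 0 + 1).
    by rewrite ltr_wpDl// le_max lexx orbT.
  move=> x y; have := hk (Num.max k 0 + 1).
  by move=> /(_ _ (x, y)); apply; rewrite // ltr_pwDr// le_max lexx.
move=> x; apply/cvgrPdist_lt => e e0.
have ek : 0 < e / k by rewrite divr_gt0.
have : \forall y \near x, `|x - y| < e / k by exact: cvgr_dist_lt.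
apply: filterS => y xy; apply: le_lt_trans (hk _ _) _.
by rewrite mulrC -ltr_pdivlMr.
Qed.

Lemma row_continuous n (h : R -> 'I_n -> R) :
  (forall i, continuous (h ^~ i)) -> continuous (fun t => \row_i h t i).
Proof.
move=> ch t; apply/cvg_ballP => e e0.
have : \forall s \near t, forall i, ball (h t i) e (h s i).
  apply: (@filter_forall R _ (fun i s => ball (h t i) e (h s i)) (nbhs t) _) => i.
  by have /cvg_ballP/(_ e e0) := ch i t.
by apply: filterS => s hs; split=> // i j; rewrite !mxE; exact: hs.
Qed.

Lemma cpath_clamp_continuous (w : cpath T) : 0 <= T ->
  continuous (fun t => w (clamp T t)).
Proof.
move=> T0 x.
have /subspace_continuousP/(_ (clamp T x)) cw := @cpath_continuous _ _ w.
have {}cw := cw (clamp_in x T0).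
have cc : clamp T t @[t --> x] --> within `[0, T] (nbhs (clamp T x)).
  move=> B wB; have {wB}cB : \forall t \near x, clamp T t \in `[0, T] -> B (clamp T t).
    exact: (@clamp_continuous _ T _ _ wB).
  suff : \forall t \near x, B (clamp T t) by [].
  by apply: filterS cB => t; apply; exact: clamp_in.
exact: (cvg_comp _ _ cc cw).
Qed.

Lemma S_G0_continuous (zeta : R -> Omega T -> R) (w : Omega T) :
  0 <= T -> S_G0 zeta -> {within `[0, T], continuous (zeta ^~ w)}.
Proof.
move=> T0 [ts [f [tsT lf zetaE]]].
(* The clamp changes nothing for [t] in [0,T] and makes the expression continuous on the whole
   line. *)
pose g t := f (t, \row_(i < size ts) (w : cpath T) (clamp T (Num.min ts`_i t))).
have cr : continuous (fun t =>
    \row_(i < size ts) (w : cpath T) (clamp T (Num.min ts`_i t))).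
  apply: (@row_continuous _ (fun t i => (w : cpath T) (clamp T (Num.min ts`_i t)))).
  move=> i s; apply: (@continuous_comp _ _ _ (fun t => Num.min ts`_i t)
    (fun t => (w : cpath T) (clamp T t))); last exact: cpath_clamp_continuous.
  exact: (continuous_min (f := fun=> ts`_i) (g := id) (cvg_cst _) cvg_id).
have cg : continuous g.
  move=> t; apply: (@continuous_comp _ _ _ (fun t =>
    (t, \row_(i < size ts) (w : cpath T) (clamp T (Num.min ts`_i t)))) f);
    last exact: bounded_lipschitz_continuous.
  have ct : (fun s => (s, \row_(i < size ts) (w : cpath T) (clamp T (Num.min ts`_i s))))
      @ nbhs t --> (nbhs t, nbhs (\row_(i < size ts) (w : cpath T)
        (clamp T (Num.min ts`_i t)))).
    by apply: cvg_pair; [exact: cvg_id | exact: cr].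
  exact: ct.
apply: (@subspace_eq_continuous _ _ _ g); last exact: continuous_subspaceT.
move=> t; rewrite inE /= in_itv /= => t0T; have /andP[t0 tT] := t0T.
rewrite /g /from_subspace zetaE//; congr (f (_, _)); apply/rowP => i; rewrite !mxE.
have /andP[i0 iT] : 0 <= ts`_i <= T by apply: tsT; exact: mem_nth.
rewrite /clamp (min_idPl _) ?ge_min ?tT ?orbT//.
by rewrite (max_idPr _)// le_min i0.
Qed.

Lemma S_G0_bounded (zeta : R -> Omega T -> R) : S_G0 zeta ->
  exists2 M, 0 <= M & forall t w, 0 <= t <= T -> `|zeta t w| <= M.
Proof.
move=> [ts [f [_ [[M [_ hM]] _] zetaE]]].
exists (Num.max M 0 + 1).
  by rewrite addr_ge0// le_max lexx orbT.
move=> t w t0T; rewrite zetaE//; apply: hM => //.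
by rewrite ltr_pwDr// le_max lexx.
Qed.

End ProcessSpace.

(** * Integrability and path continuity of processes in [S_G] *)

Section SGPaths.
Context (R : realType) (T : R) (Ps : set (probability (Omega T) R)).
Variables (P : probability (Omega T) R) (p : R) (eta : R -> Omega T -> R).
Hypotheses (PPs : Ps P) (p1 : 1 <= p) (eta_SG : S_G Ps p eta).

Let p0 : 0 < p. Proof. exact: lt_le_trans p1. Qed.

Lemma le_Ehat (X : Omega T -> \bar R) : (\int[P]_w X w <= Ehat Ps X)%E.
Proof. by apply: ereal_sup_ubound; exists P. Qed.

Lemma S_G_approx e : 0 < e -> exists zeta : R -> Omega T -> R,
  [/\ S_G0 zeta,
      measurable_fun [set: Omega T]
        (fun w => ereal_sup [set `|eta t w - zeta t w|%:E | t in `[0, T]]) &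
      (\int[P]_w ereal_sup [set (`|eta t w - zeta t w| `^ p)%:E | t in `[0%R, T]]
        <= e%:E)%E].
Proof.
move=> e0; have [_ [zeta [zeta0 mzeta zeta_cvg]]] := eta_SG.
(* The norm carries the exponent 1/p, so this tolerance in norm becomes [e] for the integral. *)
have ep : 0 < e `^ p^-1 by exact: powR_gt0.
have ep' : (0 < (e `^ p^-1)%:E)%E by rewrite lte_fin.
have [n _ /(_ n (leqnn n)) /= hn] := zeta_cvg _ (open_ereal_lt' ep').
exists (zeta n); split => //; apply: le_trans (le_Ehat _) _.
rewrite leNgt; apply/negP => eE; move: hn; rewrite /S_G_norm ltNge => /negP; apply.
rewrite -poweR_EFin; apply: gt0_ler_poweR; last exact: ltW.
- by rewrite invr_ge0 ltW.
- by rewrite in_itv/= lee_fin (ltW e0) leey.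
- by rewrite in_itv/= leey andbT (le_trans _ (ltW eE))// lee_fin ltW.
Qed.

(** For an approximation [zeta] bounded by [M], |eta| <= |eta - zeta|^p + 1 + M, because x <= x^p +
    1 whenever p >= 1. *)
Lemma S_G_integrable t : 0 <= t <= T -> P.-integrable [set: _] (EFin \o eta t).
Proof.
move=> t0T; have [zeta [zeta0 mzeta intz]] := S_G_approx (@ltr01 R).
have [M M0 hM] := S_G0_bounded zeta0.
have meta : measurable_fun [set: Omega T] (eta t) by have [+ _] := eta_SG; apply.
apply/integrableP; split; first exact/measurable_EFinP.
apply: (@le_lt_trans _ _ (1 + (M + 1)%:E)%E); last by rewrite -EFinD ltry.
apply: le_trans _ (leeD2r _ intz); apply: ge0_integral_leD_ae.
- by rewrite addr_ge0.
- by move=> w.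
- move=> w; apply: (@le_trans _ _ (`|eta t w - zeta t w| `^ p)%:E).
    by rewrite lee_fin powR_ge0.
  by apply: ereal_sup_ubound; exists t => //=; rewrite in_itv.
apply: aeW => w /=.
apply: (@le_trans _ _ ((`|eta t w - zeta t w| `^ p)%:E + (M + 1)%:E)%E); last first.
  by apply: leeD2r; apply: ereal_sup_ubound; exists t => //=; rewrite in_itv.
rewrite -EFinD lee_fin.
have := hM t w t0T; have := ler_normD (eta t w - zeta t w) (zeta t w).
rewrite subrK; set x := `|eta t w - zeta t w|.
have x0 : 0 <= x by exact: normr_ge0.
suff : x <= x `^ p + 1 by lra.
have [x1|x1] := leP 1 x; last by rewrite ler_wpDl ?powR_ge0// ltW.
by rewrite ler_wpDr// le1r_powR.
Qed.

(* The approximating process may depend on the path, so Markov's inequality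
   suffices and no almost surely convergent subsequence is extracted. *)
Lemma S_G0_uniformly_near_ae e : 0 <= T -> 0 < e -> {ae P, forall w,
  exists2 zeta, S_G0 zeta & forall t, 0 <= t <= T -> `|eta t w - zeta t w| <= e}.
Proof.
move=> T0 e0.
pose B (zeta : R -> Omega T -> R) : set (Omega T) :=
  [set w | (e%:E < ereal_sup [set `|eta t w - zeta t w|%:E | t in `[0%R, T]])%E].
have hB (k : nat) : exists zeta, [/\ S_G0 zeta, measurable (B zeta) &
    (P (B zeta) <= k.+1%:R^-1%:E)%E].
  have ep : 0 < e `^ p by exact: powR_gt0.
  have epk : 0 < e `^ p * k.+1%:R^-1 by rewrite mulr_gt0.
  have [zeta [zeta0 mzeta intz]] := S_G_approx epk.
  have mB : measurable (B zeta).
    by have := emeasurable_fun_o_infty measurableT mzeta e%:E; rewrite setTI.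
  exists zeta; split => //.
  have : ((e `^ p)%:E * P (B zeta) <= (e `^ p * k.+1%:R^-1)%:E)%E.
    apply: le_trans intz.
    have -> : ((e `^ p)%:E * P (B zeta) = \int[P]_w ((e `^ p)%:E * (\1_(B zeta) w)%:E))%E.
      rewrite ge0_integralZl//; last by rewrite lee_fin ltW.
        by rewrite integral_indic// setIT.
      by apply/measurable_EFinP; exact: measurable_indic.
    apply: ge0_le_integral_nonmeas => w.
      by rewrite mule_ge0// lee_fin ltW.
    have supge t : 0 <= t <= T -> ((`|eta t w - zeta t w| `^ p)%:E <=
        ereal_sup [set (`|eta t w - zeta t w| `^ p)%:E | t in `[0%R, T]])%E.
      by move=> tT; apply: ereal_sup_ubound; exists t => //=; rewrite in_itv.
    rewrite indicE; have [|_] := boolP (w \in B zeta); last first.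
      rewrite mule0; apply: le_trans (supge 0 _); last by rewrite lexx.
      by rewrite lee_fin powR_ge0.
    rewrite inE mule1 => /ereal_sup_gt[_ [t /= + <-]]; rewrite in_itv/= lte_fin => tT et.
    apply: le_trans (supge t tT); rewrite lee_fin.
    by apply: ge0_ler_powR; rewrite ?nnegrE ?normr_ge0 ?(ltW e0) ?(ltW p0) ?(ltW et).
  by rewrite EFinM lee_pmul2l// lte_fin.
have [zeta hzeta] := choice hB.
(* A path is bad only when every approximation fails on it, so the exceptional set lies in sets of
   probability at most 1/(k+1) for every [k]. *)
exists (\bigcap_k B (zeta k)); split.
- by apply: bigcap_measurableType => k _; have [] := hzeta k.
- apply/eqP; rewrite eq_le measure_ge0 andbT; apply/lee_addgt0Pr => r r0.
  rewrite add0e.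
  have [k rk] : exists k : nat, k.+1%:R^-1 < r.
    by have [k _ hk] := near_infty_natSinv_lt (PosNum r0); exists k; exact: hk (leqnn k).
  have [_ mBk Bk] := hzeta k.
  apply: (@le_trans _ _ (P (B (zeta k)))).
    apply: le_measure; rewrite ?inE//.
      by apply: bigcap_measurableType => j _; have [] := hzeta j.
    by move=> w; apply.
  by apply: le_trans Bk _; rewrite lee_fin ltW.
move=> w /= nw k _; apply: contrapT => nB; apply: nw.
have [zk _ _] := hzeta k; exists (zeta k) => // t tT.
rewrite leNgt; apply/negP => et; apply: nB; apply: (@lt_le_trans _ _ `|eta t w - zeta k t w|%:E).
  by rewrite lte_fin.
by apply: ereal_sup_ubound; exists t => //=; rewrite in_itv.
Qed.

(** Off one null set the path is a uniform limit of continuous paths, one approximation for each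
    error 1/(k+1). *)
Lemma S_G_ae_continuous : 0 <= T ->
  {ae P, forall w, {within `[0, T], continuous (eta ^~ w)}}.
Proof.
move=> T0.
have : {ae P, forall w, forall k : nat, exists2 zeta, S_G0 zeta &
    forall t, 0 <= t <= T -> `|eta t w - zeta t w| <= k.+1%:R^-1}.
  by apply: ae_foralln => k; exact: S_G0_uniformly_near_ae.
apply: filterS => w hw; apply/subspace_continuousP => t tT.
apply/cvgrPdist_lt => e e0.
have [k ek] : exists k : nat, k.+1%:R^-1 < e / 3.
  have e3 : 0 < e / 3 by rewrite divr_gt0.
  by have [k _ hk] := near_infty_natSinv_lt (PosNum e3); exists k; exact: hk (leqnn k).
have [zeta zeta0 hz] := hw k.
have /subspace_continuousP/(_ t tT)/cvgrPdist_lt := @S_G0_continuous _ _ _ w T0 zeta0.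
have e3 : 0 < e / 3 by rewrite divr_gt0.
move=> /(_ _ e3); rewrite !near_withinE; apply: filterS => s hs sT.
have hs1 : `|zeta t w - zeta s w| < e / 3 := hs sT.
rewrite /from_subspace; move: hs1 tT sT; rewrite /= !in_itv/= => hs1 /hz ht /hz hs'.
have := ler_distD (zeta t w) (eta t w) (eta s w).
have := ler_distD (zeta s w) (zeta t w) (eta s w).
rewrite (distrC (zeta s w) (eta s w)).
move: ek ht hs' hs1; set d := _^-1; lra.
Qed.
End SGPaths.

(** * Bi-Lipschitz bounds off a single null set *)

Section Loss.
Context (R : realType) (T : R) (Ps : set (probability (Omega T) R)).
Implicit Types (P : probability (Omega T) R) (l : Omega T -> R -> R -> R).

Lemma quasi_surely_ae P (Q : Omega T -> Prop) :
  Ps P -> quasi_surely Ps Q -> {ae P, forall w, Q w}.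
Proof.
move=> PPs [N [mN N0 hN]]; exists N; split => //.
  apply/eqP; rewrite eq_le measure_ge0 andbT -N0.
  by apply: ereal_sup_ubound; exists P.
by move=> w nQ; apply: contrapT => nN; exact/nQ/hN.
Qed.

(** The null set must not depend on [x] and [y], since random points are inserted later. Countably
    many rational pairs share one null set, and [H_l_unif], valid for every path, passes to real
    pairs. Monotonicity removes the absolute value. *)
Lemma loss_increment_ae P l (cl Cl t : R) : Ps P -> 0 <= cl <= Cl ->
  H_l Ps l -> H'_l Ps cl Cl l -> 0 <= t <= T ->
  {ae P, forall w, forall x y, x <= y ->
     cl * (y - x) <= l w t y - l w t x <= Cl * (y - x)}.
Proof.
move=> PPs /andP[cl0 clCl] Hl H'l t0T.
have mono := quasi_surely_ae PPs (H_l_mono Hl t0T).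
have lip : {ae P, forall w, forall n : nat, forall q : rat * rat, unpickle n = Some q ->
    cl * `|ratr q.1 - ratr q.2| <= `|l w t (ratr q.1) - l w t (ratr q.2)|
      <= Cl * `|ratr q.1 - ratr q.2 : R|}.
  apply: ae_foralln => n; case: (@unpickle (rat * rat)%type n) => [q|]; last first.
    by apply: aeW => w q.
  have := quasi_surely_ae PPs (H'_l_space H'l (ratr q.1) (ratr q.2) t0T).
  by apply: filterS => w h _ [<-].
apply: filterS2 mono lip => w mono lip x y.
rewrite le_eqVlt => /predU1P[->|xy]; first by rewrite !subrr !mulr0 lexx.
have lipq (q r : rat) : (ratr q : R) < ratr r ->
    cl * (ratr r - ratr q) <= l w t (ratr r) - l w t (ratr q) <= Cl * (ratr r - ratr q).
  move=> qr; have := lip (pickle (r, q)) (r, q) (pickleK _).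
  rewrite /= !gtr0_norm ?subr_gt0//; exact: mono.
have Cl0 : 0 <= Cl by exact: le_trans clCl.
have approx e : 0 < e -> exists q r : rat,
    [/\ (ratr q : R) < ratr r, `|ratr q - x| < e, `|ratr r - y| < e,
     `|l w t (ratr q) - l w t x| < e & `|l w t (ratr r) - l w t y| < e].
  move=> e0; have [d d0 hd] := H_l_unif Hl e0.
  pose g := Num.min (Num.min e d) ((y - x) / 2).
  have g0 : 0 < g by rewrite !lt_min e0 d0 /=; lra.
  have ge : g <= e by rewrite /g !ge_min lexx.
  have gd : g <= d by rewrite /g !ge_min lexx orbT.
  have gxy : g <= (y - x) / 2 by rewrite /g ge_min lexx orbT.
  have [q] := @rat_in_itvoo R (x - g) x ltac:(lra).
  have [r] := @rat_in_itvoo R y (y + g) ltac:(lra).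
  rewrite !in_itv /= => /andP[yr ry] /andP[xq qx].
  have qxg : `|ratr q - x| < g by rewrite ltr_norml; apply/andP; split; lra.
  have ryg : `|ratr r - y| < g by rewrite ltr_norml; apply/andP; split; lra.
  exists q, r; split.
  - by lra.
  - by lra.
  - by lra.
  - by apply: hd => //; [rewrite subrr normr0 | lra].
  - by apply: hd => //; [rewrite subrr normr0 | lra].
apply/andP; split; apply/ler_addgt0Pr => e e0.
  (* Moving both endpoints by less than f changes the length by at most 2 f, weighted by [cl], and
     the two values of the loss by at most 2 f in all. *)
  have k0 : 0 < 2 * cl + 2 by lra.
  have [q [r [qr]]] := approx (e / (2 * cl + 2)) (divr_gt0 e0 k0).
  set f := e / _; have fE : e = f * (2 * cl + 2) by rewrite divfK// gt_eqF.
  move/lipq : qr => /andP[+ _]; rewrite !ltr_norml.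
  move: (ratr q) (ratr r) => q' r' h /andP[h1 h2] /andP[h3 h4] /andP[h5 h6] /andP[h7 h8].
  have : cl * (y - x) <= cl * (r' - q' + 2 * f) by apply: ler_wpM2l => //; lra.
  by rewrite fE; lra.
have k0 : 0 < 2 * Cl + 2 by lra.
have [q [r [qr]]] := approx (e / (2 * Cl + 2)) (divr_gt0 e0 k0).
set f := e / _; have fE : e = f * (2 * Cl + 2) by rewrite divfK// gt_eqF.
move/lipq : qr => /andP[_ +]; rewrite !ltr_norml.
move: (ratr q) (ratr r) => q' r' h /andP[h1 h2] /andP[h3 h4] /andP[h5 h6] /andP[h7 h8].
have : Cl * (r' - q') <= Cl * (y - x + 2 * f) by apply: ler_wpM2l => //; lra.
by rewrite fE; lra.
Qed.

End Loss.

(** * Measurability and integrability of the loss at a random point *)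

Section LossComposition.
Context (R : realType) (T : R) (Ps : set (probability (Omega T) R)).
Implicit Types (P : probability (Omega T) R) (l : Omega T -> R -> R -> R).

(* A Caratheodory function: measurable in the path, continuous in x. *)
Lemma measurable_loss_comp l (t : R) (Y : Omega T -> R) : H_l Ps l ->
  0 <= t <= T -> measurable_fun [set: Omega T] Y ->
  measurable_fun [set: Omega T] (fun w => l w t (Y w)).
Proof.
move=> Hl t0T mY.
have ml x : measurable_fun [set: Omega T] (fun w => l w t x).
  by have [] := H_l_LG1 Hl x t0T.
have unif (n : nat) : exists2 d, 0 < d & forall w x y, `|x - y| < d ->
    `|l w t x - l w t y| < n.+1%:R^-1.
  have n0 : 0 < n.+1%:R^-1 :> R by [].
  have [d d0 hd] := H_l_unif Hl n0; exists d => // w x y xy.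
  by apply: hd => //; rewrite subrr normr0.
pose d n := sval (cid2 (unif n)).
have d0 n : 0 < d n by rewrite /d; case: cid2.
have hd n w x y : `|x - y| < d n -> `|l w t x - l w t y| < n.+1%:R^-1.
  by rewrite /d; case: cid2 => e /= _; apply.
apply: (measurability _ (RGenOInfty.measurableE R)) => _ [_ [a ->] <-].
rewrite setTI.
(* A margin 1/(n+1) over [a] at a rational within [d n] of [Y w] survives the move to [Y w].
   Conversely, [n] is taken with 2/(n+1) below the excess at [Y w], so that a nearby rational keeps
   the margin. *)
rewrite (_ : _ @^-1` _ = \bigcup_n \bigcup_(q : rat)
  ((Y @^-1` `]ratr q - d n, ratr q + d n[) `&`
   ((fun w => l w t (ratr q)) @^-1` `]a + n.+1%:R^-1, +oo[))).
  apply: bigcupT_measurable => n; apply: bigcupT_measurable_rat => q.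
  apply: measurableI.
    by rewrite -[X in measurable X]setTI; exact: mY.
  by rewrite -[X in measurable X]setTI; exact: ml.
apply/seteqP; split => w /=; rewrite !in_itv/= andbT; last first.
  move=> [n _ [q _ [/=]]]; rewrite !in_itv/= andbT => /andP[h1 h2] h3.
  have : `|ratr q - Y w| < d n by rewrite ltr_norml; apply/andP; split; lra.
  by move=> /(hd n w); rewrite ltr_norml => /andP[]; move: h3; set u := n.+1%:R^-1; lra.
move=> aw; have e0 : 0 < (l w t (Y w) - a) / 2 by lra.
have [n _ /(_ n (leqnn n)) /= hn] := near_infty_natSinv_lt (PosNum e0).
have [q] := @rat_in_itvoo R (Y w) (Y w + d n) ltac:(by rewrite ltrDl).
rewrite in_itv/= => /andP[h1 h2].
exists n => //; exists q => //; split; rewrite /= in_itv/=.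
  by apply/andP; split; lra.
rewrite andbT.
have : `|ratr q - Y w| < d n by rewrite ltr_norml; apply/andP; split; have := d0 n; lra.
by move=> /(hd n w); rewrite ltr_norml => /andP[h4 h5]; move: hn h4 h5; set u := n.+1%:R^-1; lra.
Qed.

Lemma integrable_loss_comp P l (cl Cl t : R) (Y : Omega T -> R) :
  Ps P -> 0 <= cl <= Cl -> H_l Ps l -> H'_l Ps cl Cl l -> 0 <= t <= T ->
  P.-integrable [set: _] (EFin \o Y) ->
  P.-integrable [set: _] (EFin \o (fun w => l w t (Y w))).
Proof.
move=> PPs clCl Hl H'l t0T iY.
have Cl0 : 0 <= Cl by have /andP[] := clCl; exact: le_trans.
have mY : measurable_fun [set: Omega T] Y by exact/measurable_EFinP/measurable_int/iY.
have mlY := measurable_loss_comp Hl t0T mY.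
have [k k0 hk] := H_l_growth Hl.
(* The growth bound has an exceptional set for each [x]; it is used at 0 only, and the Lipschitz
   bound carries it to [Y], giving |l(Y)| <= Cl |Y| + k. *)
have growth := quasi_surely_ae PPs (hk t 0 t0T).
have incr := loss_increment_ae PPs clCl Hl H'l t0T.
apply/integrableP; split; first exact/measurable_EFinP.
have fin : (\int[P]_w (Cl%:E * `|(Y w)%:E|)%E < +oo)%E.
  have /integrableP[_] := integrableZl measurableT Cl iY.
  apply: le_lt_trans; apply: ge0_le_integral_nonmeas => w.
    exact: mule_ge0.
  by rewrite abseM [in leRHS]gee0_abs //= lee_fin.
apply: (@le_lt_trans _ _ (\int[P]_w (Cl%:E * `|(Y w)%:E|)%E + k%:E)%E).
  apply: ge0_integral_leD_ae; first exact: ltW.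
  - by move=> w.
  - by move=> w; exact: mule_ge0.
  apply: filterS2 growth incr => w gw iw /=.
  rewrite -EFinM -EFinD lee_fin.
  move: gw; rewrite normr0 addr0 mulr1 => gw.
  have : `|l w t (Y w) - l w t 0| <= Cl * `|Y w|.
    have [Y0|Y0] := leP 0 (Y w).
      have /andP[h1 h2] := iw _ _ Y0.
      have : 0 <= cl * (Y w - 0) by rewrite mulr_ge0 ?subr0//; have /andP[] := clCl.
      by rewrite (ger0_norm Y0) ler_norml; move: h1 h2; rewrite subr0; lra.
    have /andP[h1 h2] := iw _ _ (ltW Y0).
    have : 0 <= cl * (0 - Y w) by rewrite mulr_ge0 ?sub0r ?oppr_ge0 ?(ltW Y0)//; have /andP[] := clCl.
    by rewrite (ltr0_norm Y0) ler_norml; move: h1 h2; rewrite sub0r; lra.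
  have := ler_normD (l w t (Y w) - l w t 0) (l w t 0); rewrite subrK; lra.
by apply: lte_add_pinfty => //; rewrite ltry.
Qed.

End LossComposition.

(** * Comparison of the losses under one measure *)

Section Stability.
Context (R : realType) (T : R) (Ps : set (probability (Omega T) R)).
Implicit Types (P : probability (Omega T) R) (l : Omega T -> R -> R -> R).

(** The pathwise chain goes from l1 at S1 + A1 to l1 at S1 + A2, gaining [cl * c]; then to l1 at S2
    + A2, losing at most Cl |S1 - S2|; then to l2 at the same point, losing at most the supremum
    over [x]. *)
Lemma SP_solution_mean_gap P (cl Cl p1 p2 c t : R) l1 l2
    (S1 S2 X1 X2 : R -> Omega T -> R) (A1 A2 : incr T) :
  Ps P -> 0 <= cl <= Cl -> 0 <= c -> 0 <= t <= T ->
  H_l Ps l1 -> H_l Ps l2 -> H'_l Ps cl Cl l1 -> H'_l Ps cl Cl l2 ->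
  H_S Ps p1 l1 S1 -> H_S Ps p2 l2 S2 ->
  SP_solution Ps p1 l1 S1 X1 A1 -> SP_solution Ps p2 l2 S2 X2 A2 ->
  c <= A1 t - A2 t ->
  (\int[P]_w (l2 w t (X2 t w))%:E + (cl * c)%:E <=
   \int[P]_w (l1 w t (X1 t w))%:E + Cl%:E * \int[P]_w `|S1 t w - S2 t w|%:E
   + \int[P]_w ereal_sup [set `|l1 w t x - l2 w t x|%:E | x in [set: R]])%E.
Proof.
move=> PPs clCl c0 t0T Hl1 Hl2 Hl1' Hl2' HS1 HS2 SP1 SP2 cA.
have /andP[cl0 cl_Cl] := clCl; have Cl0 : 0 <= Cl by exact: le_trans cl_Cl.
have iS1 := S_G_integrable PPs (H_S_p HS1) (H_S_proc HS1) t0T.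
have iS2 := S_G_integrable PPs (H_S_p HS2) (H_S_proc HS2) t0T.
have iX1 := S_G_integrable PPs (H_S_p HS1) (SP_proc SP1) t0T.
have iX2 := S_G_integrable PPs (H_S_p HS2) (SP_proc SP2) t0T.
have iU1 := integrable_loss_comp PPs clCl Hl1 Hl1' t0T iX1.
have iU2 := integrable_loss_comp PPs clCl Hl2 Hl2' t0T iX2.
have XE1 := quasi_surely_ae PPs (SP_eq SP1 t0T).
have XE2 := quasi_surely_ae PPs (SP_eq SP2 t0T).
have incr1 := loss_increment_ae PPs clCl Hl1 Hl1' t0T.
set K := fun w => ereal_sup _; pose D w := `|S1 t w - S2 t w|.
pose U1 w := l1 w t (X1 t w); pose U2 w := l2 w t (X2 t w).
have iD : P.-integrable [set: _] (EFin \o D).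
  by apply/integrable_norm; have := integrableB measurableT iS1 iS2.
have iclD : P.-integrable [set: _] (EFin \o (fun w => Cl * D w)).
  by have := integrableZl measurableT Cl iD.
have iV : P.-integrable [set: _] (EFin \o (fun w => U1 w + Cl * D w)).
  by have := integrableD measurableT iU1 iclD.
have icst : P.-integrable [set: _] (EFin \o (fun _ : Omega T => cl * c)).
  exact: finite_measure_integrable_cst.
have iW : P.-integrable [set: _] (EFin \o (fun w => U2 w + cl * c)).
  by have := integrableD measurableT iU2 icst.
have K0 w : (0 <= K w)%E.
  apply: (@le_trans _ _ `|l1 w t 0 - l2 w t 0|%:E); first by rewrite lee_fin.
  by apply: ereal_sup_ubound; exists 0.
(* All integrable terms are gathered on the left, to be separated by linearity after integration;
   [K], perhaps not measurable, stays alone on the right. *)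
have KV : {ae P, forall w, ((U2 w + cl * c - (U1 w + Cl * D w))%:E <= K w)%E}.
  apply: filterS3 XE1 XE2 incr1 => w e1 e2 h.
  apply: (@le_trans _ _ `|l1 w t (X2 t w) - l2 w t (X2 t w)|%:E); last first.
    by apply: ereal_sup_ubound; exists (X2 t w).
  rewrite lee_fin ler_normr; apply/orP; right; rewrite opprB /U1 /U2 e1 e2 /D.
  set s1 := S1 t w; set s2 := S2 t w.
  have /h /andP[h1 _] : s1 + A2 t <= s1 + A1 t by lra.
  have h2 : cl * c <= cl * (s1 + A1 t - (s1 + A2 t)) by apply: ler_wpM2l => //; lra.
  suff : `|l1 w t (s1 + A2 t) - l1 w t (s2 + A2 t)| <= Cl * `|s1 - s2|.
    by rewrite ler_norml => /andP[h3 h4]; lra.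
  have [s12|s12] := leP s2 s1.
    have /h /andP[h3 h4] : s2 + A2 t <= s1 + A2 t by lra.
    have : 0 <= cl * (s1 + A2 t - (s2 + A2 t)) by apply: mulr_ge0 => //; lra.
    have -> : `|s1 - s2| = s1 - s2 by rewrite ger0_norm// subr_ge0.
    have : 0 <= Cl * (s1 - s2) by apply: mulr_ge0 => //; lra.
    by rewrite ler_norml => ? ?; apply/andP; split; lra.
  have /h /andP[h3 h4] : s1 + A2 t <= s2 + A2 t by lra.
  have : 0 <= cl * (s2 + A2 t - (s1 + A2 t)) by apply: mulr_ge0 => //; lra.
  have -> : `|s1 - s2| = s2 - s1 by rewrite distrC gtr0_norm// subr_gt0.
  have : 0 <= Cl * (s2 - s1) by apply: mulr_ge0 => //; lra.
  by rewrite ler_norml => ? ?; apply/andP; split; lra.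
have iWV : P.-integrable [set: _] (EFin \o (fun w => U2 w + cl * c - (U1 w + Cl * D w))).
  by have := integrableB measurableT iW iV.
have := integral_le_ae (measurable_int _ iWV) K0 KV.
have -> : (\int[P]_w (U2 w + cl * c - (U1 w + Cl * D w))%:E =
    \int[P]_w (U2 w + cl * c)%:E - \int[P]_w (U1 w + Cl * D w)%:E)%E.
  exact: (integralB_EFin measurableT iW iV).
rewrite leeBlDr; last exact: integrable_fin_num iV.
have -> : (\int[P]_w (U2 w + cl * c)%:E = \int[P]_w (U2 w)%:E + (cl * c)%:E)%E.
  have -> : ((cl * c)%:E = \int[P]_w (cl * c)%:E)%E.
    by rewrite (integral_cst P measurableT (cl * c)%:E) [X in (_ * X)%E](_ : _ = 1%E)
      ?mule1//; exact: probability_setT.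
  exact: (integralD_EFin measurableT iU2 icst).
have -> : (\int[P]_w (U1 w + Cl * D w)%:E =
    \int[P]_w (U1 w)%:E + Cl%:E * \int[P]_w (D w)%:E)%E.
  rewrite -(integralZl measurableT iD).
  exact: (integralD_EFin measurableT iU1 iclD).
by rewrite (addeC (\int[P]_x K x)%E).
Qed.

End Stability.

(** * One-sided gap of the reflecting terms and distance of the solutions *)

Section StabilityBounds.
Context (R : realType) (T : R) (Ps : set (probability (Omega T) R)).
Implicit Types (P : probability (Omega T) R) (l : Omega T -> R -> R -> R).

Lemma le_of_rat_le (f : R -> R) (c : R) : 0 < T ->
  {within `[0, T], continuous f} ->
  (forall q : rat, 0 <= (ratr q : R) <= T -> f (ratr q) <= c) ->
  forall t, 0 <= t <= T -> f t <= c.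
Proof.
move=> T0 /subspace_continuousP cf fq t /andP[t0 tT]; rewrite leNgt; apply/negP => cft.
have tI : `[0, T]%classic t by rewrite /= in_itv/= t0.
have : \forall x \near t, `[0, T]%classic x -> c < f x.
  exact: (cvgr_gt (f t) (cf t tI) c cft).
move=> /nbhs_ballP[d /= d0 hd].
have [q [q0T qt]] : exists q : rat, 0 <= (ratr q : R) <= T /\ `|t - ratr q| < d.
  have [tT'|tT'] := ltP t T.
    have [q] := @rat_in_itvoo R t (Num.min (t + d) T)
      ltac:(by rewrite lt_min tT' ltrDl d0).
    rewrite in_itv/= lt_min => /andP[h1 /andP[h2 h3]]; exists q; split.
      by apply/andP; split; lra.
    by rewrite ltr_norml; apply/andP; split; lra.
  have [q] := @rat_in_itvoo R (Num.max (t - d) 0) t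
    ltac:(by rewrite gt_max; apply/andP; split; lra).
  rewrite in_itv/= gt_max => /andP[/andP[h1 h2] h3]; exists q; split.
    by apply/andP; split; lra.
  by rewrite ltr_norml; apply/andP; split; lra.
by have := hd _ qt; rewrite /= in_itv/= => /(_ q0T); rewrite ltNge fq.
Qed.

Variables (cl Cl p1 p2 : R) (l1 l2 : Omega T -> R -> R -> R).
Variables (S1 S2 X1 X2 : R -> Omega T -> R) (A1 A2 : incr T).
Hypotheses (T0 : 0 < T) (cl0 : 0 < cl) (clCl : cl < Cl).
Hypotheses (Hl1 : H_l Ps l1) (Hl2 : H_l Ps l2).
Hypotheses (Hl1' : H'_l Ps cl Cl l1) (Hl2' : H'_l Ps cl Cl l2).
Hypotheses (HS1 : H_S Ps p1 l1 S1) (HS2 : H_S Ps p2 l2 S2).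
Hypotheses (SP1 : SP_solution Ps p1 l1 S1 X1 A1).
Hypotheses (SP2 : SP_solution Ps p2 l2 S2 X2 A2).

Lemma SP_solution_incr_gap (m n : R) : 0 <= m -> 0 <= n ->
  (forall t, 0 <= t <= T -> (Ehat Ps (fun w =>
     ereal_sup [set `|l1 w t x - l2 w t x|%:E | x in [set: R]]) <= m%:E)%E) ->
  (forall t, 0 <= t <= T ->
     (Ehat Ps (fun w => `|S1 t w - S2 t w|%:E) <= n%:E)%E) ->
  forall t, 0 <= t <= T -> A1 t - A2 t <= (m + Cl * n) / cl.
Proof.
move=> m0 n0 hm hn.
have clCl' : 0 <= cl <= Cl by rewrite !ltW.
have Cl0 : 0 <= Cl by lra.
have b0 : 0 <= (m + Cl * n) / cl.
  by rewrite divr_ge0 ?(ltW cl0)// addr_ge0// mulr_ge0.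
apply: (incr_gap_le (ltW T0) b0 (SP_constraint SP1) _ (SP_flat SP1)) => c bc.
have clc : m + Cl * n < cl * c by move: bc; rewrite ltr_pdivrMr// (mulrC c).
exists ((cl * c - (m + Cl * n)) / 2); first by rewrite divr_gt0 ?subr_gt0.
(* Half of the excess is given up in the choice of a nearly optimal [P] for the second constraint;
   the other half remains as the lower bound. *)
set eps := _ / 2; have eps0 : 0 < eps by rewrite /eps; lra.
move=> r r0T cA.
have /ereal_sup_gt[_ [P PPs <-] hP] : (((- eps)%:E : \bar R) <
    Ehat Ps (fun w => (l2 w r (X2 r w))%:E))%E.
  by apply: lt_le_trans (SP_constraint SP2 r0T); rewrite lte_fin; lra.
apply: le_trans (le_Ehat PPs _).
have := SP_solution_mean_gap PPs clCl' (le_trans b0 (ltW bc)) r0T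
  Hl1 Hl2 Hl1' Hl2' HS1 HS2 SP1 SP2 (ltW cA).
have := le_trans (le_Ehat PPs _) (hm r r0T).
have := le_trans (le_Ehat PPs _) (hn r r0T).
move: hP; set v := (\int[P]_w (l2 _ _ _)%:E)%E; set u := (\int[P]_w (l1 _ _ _)%:E)%E.
set d := (\int[P]_w `|_|%:E)%E; set k := (\int[P]_w ereal_sup _)%E.
move=> hv hd hk huv.
have : ((- eps + cl * c)%:E <= u + (Cl * n + m)%:E)%E.
  rewrite EFinD; apply: (@le_trans _ _ (v + (cl * c)%:E)%E).
    by rewrite leeD2r// ltW.
  apply: (le_trans huv); rewrite -addeA leeD2l// EFinD leeD//.
  by rewrite EFinM lee_pmul2l// lte_fin (lt_trans cl0).
case: u {huv} => [u| |]; rewrite ?leey// -EFinD !lee_fin.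
by rewrite /eps; lra.
Qed.

(** The identity X = S + A is used at rational times only, where |S1 - S2| is already replaced by
    its supremum; continuity of X1 - X2 then reaches every time. *)
Lemma SP_solution_sup_dist_ae P (b : R) : Ps P ->
  (forall t, 0 <= t <= T -> `|A1 t - A2 t| <= b) ->
  {ae P, forall w, (ereal_sup [set `|X1 t w - X2 t w|%:E | t in `[0%R, T]] <=
    ereal_sup [set `|S1 t w - S2 t w|%:E | t in `[0%R, T]] + b%:E)%E}.
Proof.
move=> PPs hb.
have c1 := S_G_ae_continuous PPs (H_S_p HS1) (SP_proc SP1) (ltW T0).
have c2 := S_G_ae_continuous PPs (H_S_p HS2) (SP_proc SP2) (ltW T0).
have eqs : {ae P, forall w, forall k : nat, forall q : rat, unpickle k = Some q ->
    0 <= (ratr q : R) <= T -> X1 (ratr q) w = S1 (ratr q) w + A1 (ratr q) /\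
      X2 (ratr q) w = S2 (ratr q) w + A2 (ratr q)}.
  apply: ae_foralln => k; case: (@unpickle rat k) => [q|]; last first.
    by apply: aeW => w q.
  have [q0T|nq0T] := boolP (0 <= (ratr q : R) <= T); last first.
    by apply: aeW => w _ [<-]; rewrite (negbTE nq0T).
  have e1 := quasi_surely_ae PPs (SP_eq SP1 q0T).
  have e2 := quasi_surely_ae PPs (SP_eq SP2 q0T).
  by apply: filterS2 e1 e2 => w h1 h2 _ [<-] _.
apply: filterS3 c1 c2 eqs => w /subspace_continuousP c1 /subspace_continuousP c2 eqs.
set sS := ereal_sup [set `|S1 t w - S2 t w|%:E | t in _].
have hS t : 0 <= t <= T -> (`|S1 t w - S2 t w|%:E <= sS)%E.
  by move=> tT; apply: ereal_sup_ubound; exists t => //=; rewrite in_itv.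
have hX s t : sS = s%:E -> 0 <= t <= T -> `|X1 t w - X2 t w| <= s + b.
  move=> sE; apply: (@le_of_rat_le (fun t => `|X1 t w - X2 t w|)) => //.
    apply/subspace_continuousP => u uT.
    by apply: cvg_norm; apply: cvgB; [exact: c1|exact: c2].
  move=> q q0T; have [-> ->] := eqs (pickle q) q (pickleK q) q0T.
  have := hS _ q0T; rewrite sE lee_fin => hs.
  have := hb _ q0T.
  have := ler_normD (S1 (ratr q) w - S2 (ratr q) w) (A1 (ratr q) - A2 (ratr q)).
  rewrite (_ : _ - _ + (_ - _) = S1 (ratr q) w + A1 (ratr q) -
    (S2 (ratr q) w + A2 (ratr q))); first by lra.
  by rewrite opprD addrACA.
apply: ge_ereal_sup => _ [t /= + <-]; rewrite in_itv/= => t0T.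
have := hS 0; rewrite lexx (ltW T0) => /(_ isT).
case: sS hS hX => [s| |] _ hX //; last by move=> _; exact: leey.
by move=> _; rewrite -EFinD lee_fin hX.
Qed.

End StabilityBounds.

(** * Both estimates with a common constant *)

Unset Implicit Arguments.

Theorem proposition3p10 (R : realType) (cl Cl : R) (hcl : 0 < cl)
    (hCl : cl < Cl) :
  exists2 C : R, 0 < C &
  forall (T sl su : R) (Ps : set (probability (Omega T) R)) (p1 p2 : R)
    (l1 l2 : Omega T -> R -> R -> R) (S1 S2 X1 X2 : R -> Omega T -> R)
    (A1 A2 : incr T),
  0 < T -> 0 < sl ^+ 2 < su ^+ 2 ->
  represents_G_expectation Ps sl su ->
  H_l Ps l1 -> H_l Ps l2 ->
  H'_l Ps cl Cl l1 -> H'_l Ps cl Cl l2 ->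
  H_S Ps p1 l1 S1 -> H_S Ps p2 l2 S2 ->
  SP_solution Ps p1 l1 S1 X1 A1 -> SP_solution Ps p2 l2 S2 X2 A2 ->
  (ereal_sup [set `|A1 t - A2 t|%:E | t in `[0%R, T]] <=
     C%:E * (ereal_sup [set Ehat Ps (fun w =>
                 ereal_sup [set `|l1 w t x - l2 w t x|%:E | x in [set: R]])
               | t in `[0%R, T]]
           + ereal_sup [set Ehat Ps (fun w => `|S1 t w - S2 t w|%:E)
               | t in `[0%R, T]]))%E /\
  (Ehat Ps (fun w => ereal_sup [set `|X1 t w - X2 t w|%:E | t in `[0%R, T]]) <=
     C%:E * (ereal_sup [set Ehat Ps (fun w =>
                 ereal_sup [set `|l1 w t x - l2 w t x|%:E | x in [set: R]])
               | t in `[0%R, T]]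
           + Ehat Ps (fun w =>
               ereal_sup [set `|S1 t w - S2 t w|%:E | t in `[0%R, T]])))%E.
Proof.
pose C0 := (1 + Cl) / cl.
have Cl0 : 0 < Cl by exact: lt_trans hCl.
have C0_gt0 : 0 < C0 by rewrite divr_gt0// addr_gt0.
(* [C0] comes from (m + Cl n) / cl <= C0 (m + n); the added 1 pays for S1 - S2 itself in the
   estimate of X1 - X2. *)
exists (C0 + 1); first exact: addr_gt0.
move=> T sl su Ps p1 p2 l1 l2 S1 S2 X1 X2 A1 A2 T0 _ _ Hl1 Hl2 Hl1' Hl2' HS1 HS2 SP1 SP2.
(* Over an empty [Ps] every [Ehat] would be -oo, against the sign condition at time 0. *)
have [P0 PP0] : exists P, Ps P.
  apply: contrapT => nP; have := H_S_init HS1.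
  rewrite /Ehat (_ : [set _ | _ in Ps] = set0) ?ereal_sup0//.
  by apply/seteqP; split => // x [P PP _]; apply: nP; exists P.
have Ehat0 (X : Omega T -> \bar R) : (forall w, 0 <= X w)%E -> (0 <= Ehat Ps X)%E.
  by move=> hX; apply: le_trans (le_Ehat PP0 X); exact: integral_ge0.
have T00 : `[0, T]%classic 0 by rewrite /= in_itv/= lexx ltW.
have K0 t w : (0 <= ereal_sup [set `|l1 w t x - l2 w t x|%:E | x in [set: R]])%E.
  apply: (@le_trans _ _ `|l1 w t 0 - l2 w t 0|%:E); first by rewrite lee_fin.
  by apply: ereal_sup_ubound; exists 0.
have sS0 w : (0 <= ereal_sup [set `|S1 t w - S2 t w|%:E | t in `[0%R, T]])%E.
  apply: (@le_trans _ _ `|S1 0 w - S2 0 w|%:E); first by rewrite lee_fin.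
  by apply: ereal_sup_ubound; exists 0.
have gap m n : 0 <= m -> 0 <= n ->
    (forall t, 0 <= t <= T -> (Ehat Ps (fun w =>
      ereal_sup [set `|l1 w t x - l2 w t x|%:E | x in [set: R]]) <= m%:E)%E) ->
    (forall t, 0 <= t <= T ->
      (Ehat Ps (fun w => `|S1 t w - S2 t w|%:E) <= n%:E)%E) ->
    forall t, 0 <= t <= T -> `|A1 t - A2 t| <= C0 * (m + n).
  move=> m0 n0 hm hn t t0T.
  have mnC : (m + Cl * n) / cl <= C0 * (m + n).
    rewrite /C0 mulrAC ler_pM2r ?invr_gt0//.
    have := mulr_ge0 (ltW Cl0) m0; lra.
  (* The gap bound is one-sided; the other side is the same bound with the two problems
     exchanged. *)
  rewrite ler_norml; apply/andP; split.
    rewrite lerNl opprB; apply: le_trans mnC.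
    apply: (SP_solution_incr_gap T0 hcl hCl Hl2 Hl1 Hl2' Hl1' HS2 HS1 SP2 SP1) => // u u0T.
      apply: le_trans (hm u u0T); rewrite le_eqVlt; apply/orP; left; apply/eqP.
      congr Ehat; apply/funext => w; congr ereal_sup.
      by apply/seteqP; split=> _ [x _ <-]; exists x; rewrite // distrC.
    apply: le_trans (hn u u0T); rewrite le_eqVlt; apply/orP; left; apply/eqP.
    by congr Ehat; apply/funext => w; rewrite distrC.
  apply: le_trans mnC.
  exact: (SP_solution_incr_gap T0 hcl hCl Hl1 Hl2 Hl1' Hl2' HS1 HS2 SP1 SP2).
set M := ereal_sup [set Ehat Ps (fun w => ereal_sup _) | t in _].
set N := ereal_sup [set Ehat Ps (fun w => _%:E) | t in _].
set N' := Ehat Ps (fun w => ereal_sup [set `|S1 t w - S2 t w|%:E | t in _]).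
have hM t : 0 <= t <= T -> (Ehat Ps (fun w =>
    ereal_sup [set `|l1 w t x - l2 w t x|%:E | x in [set: R]]) <= M)%E.
  by move=> t0T; apply: ereal_sup_ubound; exists t => //=; rewrite in_itv.
have hN t : 0 <= t <= T -> (Ehat Ps (fun w => `|S1 t w - S2 t w|%:E) <= N)%E.
  by move=> t0T; apply: ereal_sup_ubound; exists t => //=; rewrite in_itv.
(* This lets [N'] serve as the bound [n] in [gap] for the second estimate. *)
have hN' t : 0 <= t <= T -> (Ehat Ps (fun w => `|S1 t w - S2 t w|%:E) <= N')%E.
  move=> t0T; apply: ge_ereal_sup => _ [P PPs <-].
  apply: le_trans (le_Ehat PPs _); apply: ge0_le_integral_nonmeas => w.
    by rewrite lee_fin.
  by apply: ereal_sup_ubound; exists t => //=; rewrite in_itv.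
have M0 : (0 <= M)%E.
  by apply: le_trans (hM 0 _); [exact: Ehat0 | rewrite lexx ltW].
have N0 : (0 <= N)%E.
  by apply: le_trans (hN 0 _); [apply: Ehat0 => w; rewrite lee_fin | rewrite lexx ltW].
have N'0 : (0 <= N')%E by exact: Ehat0.
have C1_gt0 : (0 < (C0 + 1)%:E)%E by rewrite lte_fin addr_gt0.
split.
(* An infinite supremum makes the right-hand side +oo, as the constant is positive; only finite
   bounds are left for [gap]. *)
- case: M M0 hM => [m| |] //; case: N N0 hN => [n| |] //; rewrite ?lee_fin => n0 hn m0 hm;
    rewrite ?addye ?addey// ?gt0_muley ?leey//.
  apply: ge_ereal_sup => _ [t /= + <-]; rewrite in_itv/= => t0T.
  rewrite -EFinD -EFinM lee_fin (le_trans (gap m n m0 n0 hm hn t t0T))//.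
  by rewrite ler_wpM2r ?addr_ge0// lerDl.
case: M M0 hM => [m| |] //; case E : N' N'0 hN' => [n| |] //; rewrite ?lee_fin => n0 hn m0 hm;
  rewrite ?addye ?addey// ?gt0_muley ?leey//.
have hA := gap m n m0 n0 hm hn.
have b0 : 0 <= C0 * (m + n) by rewrite mulr_ge0 ?(ltW C0_gt0) ?addr_ge0.
apply: ge_ereal_sup => _ [P PPs <-].
apply: (@le_trans _ _ (n%:E + (C0 * (m + n))%:E)%E); last first.
  by rewrite -!EFinD -EFinM lee_fin; lra.
rewrite -E; apply: le_trans (leeD2r _ (le_Ehat PPs _)).
apply: ge0_integral_leD_ae => //.
  move=> w; apply: (@le_trans _ _ `|X1 0 w - X2 0 w|%:E); first by rewrite lee_fin.
  by apply: ereal_sup_ubound; exists 0.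
exact: (SP_solution_sup_dist_ae T0 HS1 HS2 SP1 SP2 PPs hA).
Qed.
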